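(* Let $n \ge 7$ and $2 \le d \le \exp\left(\frac{n}{3}\right)$. For any algorithm for learning with expert advice there exists a sequence of losses $\ell_{t,i} \in \{0,1\}$, $1 \le i \le d$, $1 \le t \le n$, such that $$ \mathrm{Regret}^{(d)}(n) \ge \frac{1 - \exp\left(-\frac{\sqrt{\ln d}}{3.1\sqrt{2\pi}}\right)}{\sqrt{\psi\left(\frac{1.6\sqrt{\ln d}}{2\sqrt{n}}\right)}}\,\frac{\sqrt{n}}{2}\left(\sqrt{2\ln d - 2\ln\ln d} - 1\right) - \frac{\sqrt{n}}{2}. $$
   Context: Learning with expert advice is an online problem with $d$ actions and $n$ rounds ($n$, $d$ integers): in each round $t = 1,2,\dots,n$ an algorithm chooses (possibly randomly) an action $I_t \in \{1,2,\dots,d\}$ and then it receives the losses of the actions $\ell_{t,1},\ell_{t,2},\dots,\ell_{t,d} \in [0,1]$. The regret is the difference between the algorithm's cumulative loss and the cumulative loss of the best fixed action in hindsight: $$\mathrm{Regret}^{(d)}(n) = \sum_{t=1}^n \ell_{t,I_t} - \min_{1\le i\le d}\sum_{t=1}^n \ell_{t,i}.$$ $D(p\|q) = p\ln\left(\frac{p}{q}\right) + (1-p)\ln\left(\frac{1-p}{1-q}\right)$ (with $0\ln 0 = 0$) is the Kullback-Leibler divergence between the Bernoulli distributions with parameters $p$ and $q$. The function $\psi : [-\frac12,\frac12] \to \mathbb{R}$ is defined by $$\psi(x) = \frac{D\left(\frac12 + x \,\middle\|\, \frac12\right)}{2x^2},$$ with $\psi(0) = 1$. $\ln$ is the natural logarithm.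 *)

(* Defs.v *)
From mathcomp Require Import all_boot all_order all_algebra.
From mathcomp Require Import all_classical all_reals all_analysis.
Import Order.TTheory GRing.Theory Num.Theory.
Import numFieldNormedType.Exports.

Set Implicit Arguments.
Unset Strict Implicit.
Unset Printing Implicit Defensive.

Local Open Scope classical_set_scope.
Local Open Scope ring_scope.

(* The convention 0 ln 0 = 0 holds because [ln] is a total real function. *)
Definition bernoulli_KL (R : realType) (p q : R) : R :=
  p * ln (p / q) + (1 - p) * ln ((1 - p) / (1 - q)).

Definition psi (R : realType) (x : R) : R :=
  if x == 0 then 1 else bernoulli_KL (2^-1 + x) 2^-1 / (2 * x ^+ 2).

(* A possibly randomized algorithm with [d] actions: its internal randomness
   is an element of [Omega], and the action it chooses depends on that
   randomness and on the list of the loss vectors received so far (oldest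
   first).  Its own past actions are functions of these same data, so they need
   not be passed as a further argument. *)
Record expert_algorithm (R : realType) (disp : measure_display)
    (Omega : measurableType disp) (d : nat) := ExpertAlgorithm {
  choose_action :> seq ('I_d -> {i01 R}) -> Omega -> 'I_d ;
  measurable_choose_action :
    forall h i, measurable (choose_action h @^-1` [set i]) }.

Definition loss_history (R : realType) (n d : nat)
    (loss : 'I_n -> 'I_d -> {i01 R}) (t : 'I_n) : seq ('I_d -> {i01 R}) :=
  [seq loss s | s : 'I_n <- enum 'I_n & (s < t)%N].

Definition played (R : realType) (disp : measure_display)
    (Omega : measurableType disp) (n d : nat)
    (A : expert_algorithm R Omega d) (loss : 'I_n -> 'I_d -> {i01 R})
    (w : Omega) (t : 'I_n) : 'I_d :=
  A (loss_history loss t) w.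

(* For [0 < d] the infimum of this finite set is a minimum. *)
Definition best_loss (R : realType) (n d : nat)
    (loss : 'I_n -> 'I_d -> {i01 R}) : R :=
  inf (range (fun i : 'I_d => \sum_(t < n) (loss t i)%:num)).

Definition regret (R : realType) (disp : measure_display)
    (Omega : measurableType disp) (n d : nat)
    (A : expert_algorithm R Omega d) (loss : 'I_n -> 'I_d -> {i01 R})
    (w : Omega) : R :=
  \sum_(t < n) (loss t (played A loss w t))%:num - best_loss loss.

(* Main.v *)
(* Draw the losses as independent fair bits. Any algorithm then has expected loss
   n / 2, so its expected regret is half the expected maximum of d independent
   simple random walks of length n, and some realization does at least as well.
   When ln d <= 4 the bound is nonpositive. Otherwise the binomial probabilities
   are bounded below by Stirling's formula, in terms of the divergence from 1/2,
   and summed over a window of about (7 / 12) sqrt n consecutive values ending at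
   (sqrt n / sqrt psi) sqrt (2 ln d - 2 ln ln d), where the monotonicity of psi
   keeps each of them at least ln d / (2 d sqrt n). This gives the probability
   that the maximum exceeds the bottom of the window; when it does not, the
   maximum is bounded below by a single walk, at a cost of order sqrt n. *)
Require Import Defs.
From mathcomp Require Import all_boot all_order all_algebra.
From mathcomp Require Import all_classical all_reals all_analysis.
From mathcomp Require Import measurable_realfun ring lra zify.
Import Order.TTheory GRing.Theory Num.Theory.
Import numFieldNormedType.Exports.

Set Implicit Arguments.
Unset Strict Implicit.
Unset Printing Implicit Defensive.

Local Open Scope classical_set_scope.
Local Open Scope ring_scope.

(** * Estimates and monotonicity for the divergence from the fair coin *)

Section divergence.
Variable R : realType.

Lemma le_is_derive_ge0 (f df : R -> R) (a b : R) : a <= b ->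
  (forall x, a <= x <= b -> is_derive x 1 f (df x)) ->
  (forall x, a <= x <= b -> 0 <= df x) -> f a <= f b.
Proof.
move=> ab fd df0.
have [||c cab fE] := @MVT_segment R f df a b ab.
- by move=> x /[!in_itv]/= /andP[ax xb]; apply: fd; rewrite !ltW.
- apply: continuous_in_subspaceT => x /[!inE]/= /[!in_itv]/= xab.
  apply: differentiable_continuous; apply/derivable1_diffP.
  by have [] := fd x xab.
- by rewrite -subr_ge0 fE mulr_ge0 ?subr_ge0// df0.
Qed.

Lemma is_derive_ln1D (c x : R) : 0 < 1 + c * x ->
  is_derive x 1 (fun t => ln (1 + c * t)) (c / (1 + c * x)).
Proof.
move=> x0.
have Dl : is_derive (1 + c * x) 1 (@ln R) (1 + c * x)^-1 by exact: is_derive1_ln.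
have Da : is_derive x 1 (fun t : R => 1 + c * t) c.
  apply: is_derive_eq.
  by rewrite /GRing.scale/=; ring.
have := @is_derive1_comp R (@ln R) (fun t => 1 + c * t) x _ _ Dl Da.
by move=> H; apply: (is_derive_eq H); rewrite mulrC.
Qed.

(** The difference vanishes at 0 and has derivative [ln (1 + t) + 1 / (1 + t) - 1]. The case [x = 1]
    gives [ln 2 >= 2 / 3], used below. *)
Lemma ln1D_ge (x : R) : 0 <= x -> 2 * x <= (2 + x) * ln (1 + x).
Proof.
move=> x0.
pose f := fun t : R => (2 + t) * ln (1 + 1 * t) - 2 * t.
have : f 0 <= f x.
  apply: (@le_is_derive_ge0 f (fun t =>
      ln (1 + 1 * t) + (2 + t) * (1 / (1 + 1 * t)) - 2)); rewrite /f//.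
    move=> t /andP[t0 _].
    have Dl := @is_derive_ln1D 1 t ltac:(lra).
    by apply: is_derive_eq; rewrite /GRing.scale/=; ring.
  move=> t /andP[t0 _]; rewrite !mul1r.
  have t1 : 0 < 1 + t by lra.
  (* [ln (1 + u) <= u] at [u = 1 / (1 + t) - 1] bounds [- ln (1 + t)] from above. *)
  have : ln (1 + ((1 + t)^-1 - 1)) <= (1 + t)^-1 - 1.
    by rewrite le_ln1Dx// ltrBrDr addNr invr_gt0.
  rewrite addrC subrK lnV ?posrE//.
  have -> : (2 + t) * (1 + t)^-1 = 1 + (1 + t)^-1 by field; lra.
  lra.
rewrite /f !mulr0 !addr0 ln1 mul1r; lra.
Qed.

Lemma ln1D_le (x : R) : 0 <= x -> 2 * (1 + x) * ln (1 + x) <= x * (2 + x).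
Proof.
move=> x0.
pose f := fun t : R => t * (2 + t) - 2 * (1 + t) * ln (1 + 1 * t).
have : f 0 <= f x.
  apply: (@le_is_derive_ge0 f (fun t =>
      2 * (t - ln (1 + t)))); rewrite /f//.
    move=> t /andP[t0 _].
    have Dl := @is_derive_ln1D 1 t ltac:(lra).
    apply: is_derive_eq; rewrite /GRing.scale/= !mul1r; field; lra.
  move=> t /andP[t0 _]; have := @le_ln1Dx R t ltac:(lra); lra.
rewrite /f !mul1r !addr0 ln1; lra.
Qed.

(* Twice the divergence of Bernoulli((1 + y) / 2) from Bernoulli(1 / 2). *)
Definition ent (y : R) := (1 + y) * ln (1 + y) + (1 - y) * ln (1 - y).

Lemma is_derive_ent (y : R) : -1 < y < 1 ->
  is_derive y 1 ent (ln (1 + y) - ln (1 - y)).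
Proof.
move=> /andP[y0 y1].
have Dp := @is_derive_ln1D 1 y ltac:(lra).
have Dm := @is_derive_ln1D (-1) y ltac:(lra).
have -> : ent = fun y => (1 + y) * ln (1 + 1 * y) + (1 - y) * ln (1 + (-1) * y).
  by apply/funext => z; rewrite /ent mul1r mulN1r.
apply: is_derive_eq; rewrite /GRing.scale/= !(mul1r, mulN1r); field; lra.
Qed.

(** The substitution [x = 2 y / (1 - y)], for which [1 + x = (1 + y) / (1 - y)], turns [ln1D_ge]
    into a bound on the derivative of [ent]; [ln1D_le] yields the next lemma likewise. *)
Lemma ln_ratio_ge (y : R) : 0 <= y < 1 -> 2 * y <= ln (1 + y) - ln (1 - y).
Proof.
move=> /andP[y0 y1].
set x := 2 * y / (1 - y).
have x0 : 0 <= x by rewrite divr_ge0//; lra.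
have E : 1 + x = (1 + y) / (1 - y) by rewrite /x; field; lra.
have := ln1D_ge x0.
rewrite E ln_div ?posrE; [|lra|lra].
have -> : 2 + x = 2 / (1 - y) by rewrite /x; field; lra.
have -> : 2 * x = 2 / (1 - y) * (2 * y) by rewrite /x; field; lra.
by rewrite ler_pM2l// divr_gt0//; lra.
Qed.

Lemma ln_ratio_le (y : R) : 0 <= y < 1 ->
  ln (1 + y) - ln (1 - y) <= (1 - y)^-1 - (1 + y)^-1.
Proof.
move=> /andP[y0 y1].
set x := 2 * y / (1 - y).
have x0 : 0 <= x by rewrite divr_ge0//; lra.
have E : 1 + x = (1 + y) / (1 - y) by rewrite /x; field; lra.
have := ln1D_le x0.
rewrite E ln_div ?posrE; [|lra|lra].
have -> : x * (2 + x) = 2 * ((1 + y) / (1 - y)) * ((1 - y)^-1 - (1 + y)^-1).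
  by rewrite /x; field; lra.
by rewrite ler_pM2l// mulr_gt0// divr_gt0//; lra.
Qed.

Lemma ent_ge (y : R) : 0 <= y < 1 -> y ^+ 2 <= ent y.
Proof.
move=> /andP[y0 y1].
pose f := fun t : R => ent t - t * t.
have : f 0 <= f y.
  apply: (@le_is_derive_ge0 f (fun t =>
      ln (1 + t) - ln (1 - t) - 2 * t)); rewrite /f//.
    move=> t t01; have Dg := @is_derive_ent t ltac:(lra).
    by apply: is_derive_eq; rewrite /GRing.scale/=; ring.
  move=> t t01; have := @ln_ratio_ge t ltac:(lra); lra.
rewrite /f /ent addr0 subr0 ln1 expr2; lra.
Qed.

Lemma ent_le (y : R) : 0 <= y < 1 -> ent y <= 2 * y ^+ 2.
Proof.
move=> /andP[y0 y1]; rewrite /ent.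
have := @le_ln1Dx R y ltac:(lra); have := @le_ln1Dx R (- y) ltac:(lra).
nra.
Qed.

(* [2 ent y <= y ent' y] is the nonnegativity of the derivative of [ent y / y ^ 2]. *)
Lemma ent_le_deriv (y : R) : 0 <= y < 1 -> 2 * ent y <= y * (ln (1 + y) - ln (1 - y)).
Proof.
move=> /andP[y0 y1].
pose f := fun t : R => t * (ln (1 + 1 * t) - ln (1 + (-1) * t)) - 2 * ent t.
have : f 0 <= f y.
  apply: (@le_is_derive_ge0 f (fun t =>
      (1 - t)^-1 - (1 + t)^-1 - (ln (1 + t) - ln (1 - t)))); rewrite /f//.
    move=> t t01; have Dg := @is_derive_ent t ltac:(lra).
    have Dp := @is_derive_ln1D 1 t ltac:(lra).
    have Dm := @is_derive_ln1D (-1) t ltac:(lra).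
    by apply: is_derive_eq; rewrite /GRing.scale/= !(mul1r, mulN1r); field; lra.
  by move=> t t01; rewrite subr_ge0; apply: ln_ratio_le; lra.
rewrite /f /ent !mulr0 mul0r !addr0 subr0 ln1 !mul1r !mulN1r; lra.
Qed.

(** This is the monotonicity of [psi], in the variable [y = 2 x] of [psiE]. *)
Lemma ent_div_sqr_homo (y z : R) : 0 < y -> y <= z -> z < 1 ->
  ent y / y ^+ 2 <= ent z / z ^+ 2.
Proof.
move=> y0 yz z1.
pose f := fun t : R => ent t * (t^-1 * t^-1).
have : f y <= f z.
  apply: (@le_is_derive_ge0 f (fun t =>
      (t * (ln (1 + t) - ln (1 - t)) - 2 * ent t) / (t * t * t))); rewrite /f//.
    move=> t t01; have Dg := @is_derive_ent t ltac:(lra).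
    have tn0 : id t != 0 :> R by rewrite /=; lra.
    have Dv := @is_deriveV R id t 1 1 tn0 (is_derive_id _ _).
    by apply: is_derive_eq; rewrite /GRing.scale/=; field; lra.
  move=> t t01; have := @ent_le_deriv t ltac:(lra) => h.
  by rewrite divr_ge0 ?subr_ge0// !mulr_ge0//; lra.
by rewrite /f -!invfM -!expr2.
Qed.

Lemma psiE (x : R) : 0 < x -> x < 2^-1 -> psi x = ent (2 * x) / (2 * x) ^+ 2.
Proof.
move=> x0 x1; rewrite /psi gt_eqF// /bernoulli_KL /ent.
have h : (2^-1 : R) = 1 - 2^-1 by field.
have -> : (2^-1 + x) / 2^-1 = 1 + 2 * x by field.
have -> : (1 - (2^-1 + x)) / (1 - 2^-1) = 1 - 2 * x by field; lra.
by field; lra.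
Qed.
End divergence.

(** * Stirling bounds and binomial probabilities *)

Section stirling.
Variable R : realType.

(** For [n > 0], the logarithm of [n! / (sqrt n (n / e) ^ n)], which decreases to
    [ln (sqrt (2 pi))], about 0.919. *)
Definition stirling_remainder (n : nat) : R :=
  ln (n`!%:R) - (n%:R + 2^-1) * ln n%:R + n%:R.

(** The decrement is [(n + 1 / 2) ln (1 + 1 / n) - 1]; [ln1D_ge] and [ln1D_le] at [x = 1 / n] bound
    it, the latter by a telescoping term. *)
Lemma stirling_remainderS (n : nat) : (0 < n)%N ->
  0 <= stirling_remainder n - stirling_remainder n.+1 <=
    (n%:R^-1 - n.+1%:R^-1) / 4.
Proof.
move=> n0; have n0' : 0 < n%:R :> R by rewrite ltr0n.
have S0 : 0 < n.+1%:R :> R by rewrite ltr0n.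
have f0 : 0 < n`!%:R :> R by rewrite ltr0n fact_gt0.
have x0 : 0 <= n%:R^-1 :> R by rewrite invr_ge0 ltW.
have E : stirling_remainder n - stirling_remainder n.+1 =
    (n%:R + 2^-1) * ln (1 + n%:R^-1) - 1.
  have -> : 1 + n%:R^-1 = n.+1%:R / n%:R :> R.
    by rewrite -natr1; field; rewrite gt_eqF.
  rewrite /stirling_remainder factS natrM lnM ?posrE// ln_div ?posrE// -natr1.
  by field.
have := ln1D_ge x0; have := ln1D_le x0; rewrite E.
set l := ln _.
have [S n_ne] : n.+1%:R = n%:R + 1 :> R /\ n%:R != 0 :> R.
  by rewrite natr1 gt_eqF.
move=> h1 h2; apply/andP; split.
  have -> : (n%:R + 2^-1) * l - 1 = n%:R / 2 * ((2 + n%:R^-1) * l - 2 * n%:R^-1).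
    by field.
  by rewrite mulr_ge0 ?subr_ge0// divr_ge0// ltW.
rewrite -subr_ge0.
have -> : (n%:R^-1 - n.+1%:R^-1) / 4 - ((n%:R + 2^-1) * l - 1) =
  n%:R * (2 * n%:R + 1) / (4 * (n%:R + 1)) *
    (n%:R^-1 * (2 + n%:R^-1) - 2 * (1 + n%:R^-1) * l) :> R.
  by rewrite S; field; rewrite n_ne; lra.
rewrite mulr_ge0 ?subr_ge0// divr_ge0//; nra.
Qed.

Lemma stirling_remainder_bounds (n : nat) : (0 < n)%N ->
  3 / 4 <= stirling_remainder n <= 1.
Proof.
move=> n0.
(* The extra [1 / (4 n)] absorbs the decrements, and at [n = 1] both bounds equal 1. *)
suff : 3 / 4 + n%:R^-1 / 4 <= stirling_remainder n <= 1.
  have : 0 <= n%:R^-1 :> R by rewrite invr_ge0.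
  lra.
elim: n n0 => [//|[_ _|n IH _]].
  by rewrite /stirling_remainder factS fact0 muln1 ln1 invr1; lra.
have := IH isT; have := @stirling_remainderS n.+1 isT.
set u := n.+1%:R^-1; set v := n.+2%:R^-1; lra.
Qed.

(** Stirling's formula leaves the factor [sqrt (n / (k m)) >= 2 / sqrt n], by the AM-GM step [km],
    and remainders of total at least [3 / 4 - 1 - 1]. The constant [1 / 2] then follows from
    [2 ln 2 >= 4 / 3 >= 5 / 4]. *)
Lemma binomial_pmf_ge (k m : nat) (n := (k + m)%N) : (0 < k)%N -> (0 < m)%N ->
  expR (- (n%:R / 2 * ent ((k%:R - m%:R) / n%:R))) / (2 * Num.sqrt n%:R)
    <= 'C(n, k)%:R / 2 ^+ n :> R.
Proof.
move=> k0 m0.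
have K : 0 < k%:R :> R by rewrite ltr0n.
have M : 0 < m%:R :> R by rewrite ltr0n.
have nE : n%:R = k%:R + m%:R :> R by rewrite natrD.
have N : 0 < n%:R :> R by lra.
have nn : (0 < n)%N by rewrite -(ltr0n R).
have C0 : 0 < 'C(n, k)%:R :> R by rewrite ltr0n bin_gt0 leq_addr.
have fk : 0 < k`!%:R :> R by rewrite ltr0n fact_gt0.
have fm : 0 < m`!%:R :> R by rewrite ltr0n fact_gt0.
have CE : ln (n`!%:R : R) = ln ('C(n, k)%:R : R) + (ln (k`!%:R : R) + ln (m`!%:R : R)).
  by rewrite -(@bin_fact n k) ?leq_addr// addKn !natrM !lnM ?posrE ?mulr_gt0.
have eE : ent ((k%:R - m%:R) / n%:R) =
    2 * k%:R / n%:R * (ln 2 + ln k%:R - ln n%:R) +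
    2 * m%:R / n%:R * (ln 2 + ln m%:R - ln n%:R) :> R.
  rewrite /ent.
  have -> : 1 + (k%:R - m%:R) / n%:R = 2 * k%:R / n%:R :> R by rewrite nE; field; lra.
  have -> : 1 - (k%:R - m%:R) / n%:R = 2 * m%:R / n%:R :> R by rewrite nE; field; lra.
  by rewrite !ln_div ?posrE ?mulr_gt0// !lnM ?posrE.
have km : ln k%:R + ln m%:R <= 2 * (ln n%:R - ln 2) :> R.
  rewrite -lnM ?posrE// -ln_div ?posrE// [leRHS]mulr_natl.
  rewrite -lnXn ?divr_gt0// ler_ln ?posrE ?mulr_gt0 ?exprn_gt0 ?divr_gt0//.
  rewrite nE -subr_ge0 (_ : _ - _ = ((k%:R - m%:R) / 2) ^+ 2); last by field.
  exact: sqr_ge0.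
have l2 := @ln1D_ge R 1 ler01.
have := stirling_remainder_bounds nn; have := stirling_remainder_bounds k0.
have := stirling_remainder_bounds m0; rewrite /stirling_remainder CE => bm bk bn.
have s0 : 0 < Num.sqrt n%:R :> R by rewrite sqrtr_gt0.
rewrite -ler_ln ?posrE ?divr_gt0 ?expR_gt0 ?mulr_gt0 ?exprn_gt0//.
rewrite !ln_div ?posrE ?expR_gt0 ?mulr_gt0 ?exprn_gt0// lnM ?posrE// expRK.
rewrite lnXn// -[ln _ *+ n]mulr_natl eE.
have lns : ln (Num.sqrt n%:R) = ln n%:R / 2 :> R.
  by rewrite -[in RHS](sqr_sqrtr (ltW N)) lnXn// -[ln _ *+ 2]mulr_natl; field.
rewrite lns.
have -> : n%:R / 2 * (2 * k%:R / n%:R * (ln 2 + ln k%:R - ln n%:R) +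
    2 * m%:R / n%:R * (ln 2 + ln m%:R - ln n%:R)) =
   k%:R * (ln 2 + ln k%:R - ln n%:R) + m%:R * (ln 2 + ln m%:R - ln n%:R) :> R.
  by field; lra.
move: bn bk bm km; rewrite nE; lra.
Qed.
End stirling.

(** * Averages over uniformly random binary losses *)

Lemma card_set_type (T : finType) : #|{: {set T}}| = (2 ^ #|T|)%N.
Proof. by rewrite -[in RHS]cardsT -card_powerset powersetT cardsT. Qed.

Section random_losses.
Variables (R : realType) (n d : nat).
(* Action [i] has loss 0 in the rounds of [f i] and loss 1 in the others. *)
Local Notation losses := {ffun 'I_d -> {set 'I_n}}.

Definition flip (t : 'I_n) (f : losses) : losses :=
  [ffun i => [set s | (s \in f i) (+) (s == t)]%SET].

Lemma in_flip t f i s : (s \in flip t f i) = (s \in f i) (+) (s == t).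
Proof. by rewrite ffunE inE. Qed.

Lemma flipK t : involutive (flip t).
Proof. by move=> f; apply/ffunP => i; apply/setP => s; rewrite !in_flip addbK. Qed.

(** Reindexing by the involution [flip t] equates the sum with its opposite. This stands in for the
    fairness and independence of the bits of round [t]. *)
Lemma sum_flip_odd t (F : losses -> R) :
  (forall f, F (flip t f) = - F f) -> \sum_f F f = 0.
Proof.
move=> Fodd; set S := \sum_f F f.
suff : S = - S by lra.
rewrite {1}/S (reindex_inj (inv_inj (flipK t))) -sumrN.
exact: eq_bigr.
Qed.

(** Rounds with loss 0 minus rounds with loss 1, so that action [i] has total loss
    [(n - walk i f) / 2]. *)
Definition walk (i : 'I_d) (f : losses) : R := 2 * #|f i|%:R - n%:R.

Definition step (i : 'I_d) (t : 'I_n) (f : losses) : R := (-1) ^+ (t \notin f i).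

Lemma walkE i f : walk i f = \sum_t step i t f.
Proof.
have E t : step i t f = 2 * (t \in f i)%:R - 1.
  by rewrite /step; case: (t \in f i); rewrite /= ?expr0 ?expr1; lra.
rewrite (eq_bigr _ (fun t _ => E t)) sumrB sumr_const card_ord -mulr_sumr.
rewrite /walk -natr_sum -sum1_card [in LHS]big_mkcond /=.
by congr (2 * _%:R - _); apply: eq_bigr => t _; case: ifP.
Qed.

Lemma step_flip i t s f : step i s (flip t f) = (-1) ^+ (s == t) * step i s f.
Proof. by rewrite /step in_flip -signr_addb; case: (s \in f i) (s == t) => [] []. Qed.

Lemma sum_walk i : \sum_f walk i f = 0.
Proof.
under eq_bigr do rewrite walkE.
rewrite exchange_big big1// => t _; apply: (@sum_flip_odd t) => f.
by rewrite step_flip eqxx expr1 mulN1r.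
Qed.

(** In the expanded square the diagonal terms are 1, and a product of steps at distinct rounds is
    odd under a flip of one of them. *)
Lemma sum_sqr_walk i : \sum_f walk i f ^+ 2 = n%:R * #|{: losses}|%:R.
Proof.
under eq_bigr do rewrite walkE expr2 big_distrlr /=.
rewrite exchange_big (eq_bigr (fun=> #|{: losses}|%:R)); last first.
  move=> t _; rewrite exchange_big (bigD1 t)//= [X in _ + X]big1 ?addr0.
    by under eq_bigr do rewrite -expr2 sqrr_sign; rewrite sumr_const.
  move=> s st; apply: (@sum_flip_odd s) => f.
  by rewrite !step_flip eqxx eq_sym (negbTE st) expr1 expr0 mul1r mulN1r mulrN.
by rewrite sumr_const card_ord mulr_natl.
Qed.

(** The [f i] are independent and uniform: the families avoiding [E] are exactly the functions into
    its complement. *)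
Lemma sum_exists (E : pred {set 'I_n}) :
  \sum_(f : losses) ([exists i, E (f i)])%:R =
    #|{: losses}|%:R * (1 - (1 - #|E|%:R / 2 ^+ n) ^+ d) :> R.
Proof.
have cT : #|{: losses}|%:R = (2 ^+ n) ^+ d :> R.
  by rewrite card_ffun card_set_type !card_ord !natrX.
have cE : #|predC E|%:R = 2 ^+ n - #|E|%:R :> R.
  have -> : 2 ^+ n = (#|E| + #|predC E|)%:R :> R.
    by rewrite cardC card_set_type card_ord natrX.
  by rewrite natrD addrC addKr.
pose Q : pred losses := fun f => [exists i, E (f i)].
have cQ : #|predC Q|%:R = (2 ^+ n - #|E|%:R) ^+ d :> R.
  rewrite -cE -natrX -[X in (_ ^ X)%N](card_ord d) -card_ffun_on; congr _%:R.
  apply: eq_card => f; rewrite !inE negb_exists.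
  by apply/forallP/ffun_onP => H i; exact: H.
have -> : \sum_(f : losses) ([exists i, E (f i)])%:R =
    #|{: losses}|%:R - #|predC Q|%:R :> R.
  rewrite -(cardC Q) natrD addrK -natr_sum -sum1_card [in RHS]big_mkcond/=.
  by congr _%:R; apply: eq_bigr => f _; rewrite unfold_in /Q; case: ifP.
rewrite cQ cT mulrBr mulr1 -exprMn; congr (_ - _ ^+ _).
by field; rewrite expf_neq0.
Qed.

Lemma sum_gap_ge0 (M : losses -> R) : (0 < d)%N ->
  (forall f i, M f <= n%:R - #|f i|%:R) -> 0 <= \sum_f (n%:R / 2 - M f).
Proof.
move=> d0 hM.
have w0 : \sum_f walk (Ordinal d0) f / 2 = 0 by rewrite -mulr_suml sum_walk mul0r.
rewrite -{1}w0.
by apply: ler_sum => f _; have := hM f (Ordinal d0); rewrite /walk; lra.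
Qed.

(* If some walk reaches [C], the gap is at least [C / 2];
   elsewhere a single walk [Z] bounds it by [Z / 2], and
   [Z >= - (Z - sqrt n) ^ 2 / (4 sqrt n)] has mean [- sqrt n / 2] on the right. *)
Lemma sum_gap_ge (M : losses -> R) (C : R) (E : pred {set 'I_n}) :
  (0 < n)%N -> (0 < d)%N -> 0 <= C ->
  (forall f i, M f <= n%:R - #|f i|%:R) ->
  (forall A : {set 'I_n}, E A -> C <= 2 * #|A|%:R - n%:R) ->
  #|{: losses}|%:R *
    (C / 2 * (1 - (1 - #|E|%:R / 2 ^+ n) ^+ d) - Num.sqrt n%:R / 4)
  <= \sum_f (n%:R / 2 - M f).
Proof.
move=> n0 d0 C0 hM hE; pose i0 := Ordinal d0.
set r := Num.sqrt n%:R.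
have r0 : 0 < r by rewrite sqrtr_gt0 ltr0n.
have r2 : r ^+ 2 = n%:R by rewrite sqr_sqrtr.
have -> : #|{: losses}|%:R *
    (C / 2 * (1 - (1 - #|E|%:R / 2 ^+ n) ^+ d) - r / 4) =
  \sum_(f : losses) (C / 2 * ([exists i, E (f i)])%:R - (walk i0 f - r) ^+ 2 / (8 * r)).
  rewrite sumrB -mulr_sumr sum_exists -mulr_suml.
  rewrite (_ : \sum_f _ = \sum_f (walk i0 f ^+ 2 - 2 * r * walk i0 f + r ^+ 2)); last first.
    by apply: eq_bigr => f _; ring.
  rewrite big_split/= sumrB sum_sqr_walk -mulr_sumr sum_walk mulr0 sumr_const subr0.
  by rewrite -r2 -[_ *+ #|_|]mulr_natr; field; rewrite gt_eqF.
apply: ler_sum => f _.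
have q0 : 0 <= (walk i0 f - r) ^+ 2 / (8 * r).
  by rewrite divr_ge0 ?sqr_ge0// mulr_ge0// ltW.
case: existsP => [[i /hE]|_] /=.
  by have := hM f i; lra.
rewrite mulr0 sub0r.
(* Completing the square: this is [Z / 2 >= - (Z - r) ^ 2 / (8 r)] for [Z = walk i0 f]. *)
have h : 0 <= (walk i0 f + r) ^+ 2 / (8 * r).
  by rewrite divr_ge0 ?sqr_ge0// mulr_ge0// ltW.
have : (walk i0 f + r) ^+ 2 / (8 * r) = (walk i0 f - r) ^+ 2 / (8 * r) + walk i0 f / 2.
  by field; rewrite gt_eqF.
have := hM f i0; have : walk i0 f = 2 * #|f i0|%:R - n%:R by []; lra.
Qed.
End random_losses.

(** * From averaged losses to the expected regret of an algorithm *)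

Section regret.
Variables (R : realType) (n d : nat).
Local Notation losses := {ffun 'I_d -> {set 'I_n}}.

Definition loss_of (f : losses) (t : 'I_n) (i : 'I_d) : {i01 R} :=
  if t \in f i then 0%:i01 else 1%:i01.

Lemma loss_ofE f t i : (loss_of f t i)%:num = (t \notin f i)%:R.
Proof. by rewrite /loss_of; case: ifP. Qed.

Lemma best_loss_of_le f i : best_loss (loss_of f) <= n%:R - #|f i|%:R.
Proof.
have -> : n%:R - #|f i|%:R = \sum_(t < n) (loss_of f t i)%:num.
  under eq_bigr do rewrite loss_ofE.
  have -> : n%:R = #|f i|%:R + #|[predC f i]|%:R :> R by rewrite -natrD cardC card_ord.
  by rewrite addrC addKr -natr_sum -sum1_card [in LHS]big_mkcond/=; congr _%:R.
apply: ge_inf; last by exists i.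
exists 0 => _ [j _ <-]; apply: sumr_ge0 => t _.
by rewrite loss_ofE.
Qed.

Section algorithm.
Variables (disp : measure_display) (Omega : measurableType disp).
Variables (P : probability Omega R) (A : expert_algorithm R Omega d).

(** The history at round [t] holds only earlier rounds, so flipping round [t] leaves the action
    chosen there unchanged. *)
Lemma loss_history_flip f t : loss_history (loss_of (flip t f)) t = loss_history (loss_of f) t.
Proof.
apply/eq_in_map => s; rewrite mem_filter => /andP[st _].
apply/funext => i; rewrite /loss_of in_flip.
by rewrite (_ : s == t = false) ?addbF//; apply/eqP => E; rewrite E ltnn in st.
Qed.

(** For each fixed randomness, the loss incurred in round [t] minus [1 / 2] is odd under
    [flip t]. *)
Lemma sum_played_loss (w : Omega) :
  \sum_f (\sum_(t < n) (loss_of f t (played A (loss_of f) w t))%:num - n%:R / 2) = 0.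
Proof.
have -> : n%:R / 2 = \sum_(t < n) 2^-1 :> R by rewrite sumr_const card_ord mulr_natl.
under eq_bigr do rewrite -sumrB.
rewrite exchange_big big1//= => t _; apply: (@sum_flip_odd R n d t) => f.
rewrite /played loss_history_flip !loss_ofE in_flip eqxx addbT.
by case: (t \in _); rewrite /=; lra.
Qed.

Lemma sum_regret (w : Omega) :
  \sum_f regret A (loss_of f) w = \sum_f (n%:R / 2 - best_loss (loss_of f)).
Proof.
apply/eqP; rewrite -subr_eq0 -sumrB -[X in _ == X](sum_played_loss w); apply/eqP.
by apply: eq_bigr => f _; rewrite /regret; ring.
Qed.

Lemma measurable_regret (loss : 'I_n -> 'I_d -> {i01 R}) :
  measurable_fun setT (regret A loss).
Proof.
apply: measurable_funB => //; apply: measurable_sum => t.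
(* Splitting over the finitely many actions reduces measurability to that of the events on which
   each is chosen. *)
have -> : (fun w => (loss t (played A loss w t))%:num) =
    (fun w => \sum_(i < d) (loss t i)%:num * \1_(A (loss_history loss t) @^-1` [set i]) w).
  apply/funext => w; rewrite (bigD1 (played A loss w t))//= big1 ?addr0.
    by rewrite indicE mem_set ?mulr1.
  move=> i ip; rewrite indicE memNset ?mulr0//= => pi.
  by move: ip; rewrite /played pi eqxx.
apply: measurable_sum => i; apply: measurable_funM => //.
exact/measurable_indic/measurable_choose_action.
Qed.

Lemma integrable_regret (loss : 'I_n -> 'I_d -> {i01 R}) :
  P.-integrable setT (EFin \o regret A loss).
Proof.
apply: measurable_bounded_integrable => //.
- by rewrite (le_lt_trans (probability_le1 _ _))// ltry.
- exact: measurable_regret.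
exists (n%:R + `|best_loss loss|); split; first exact: num_real.
move=> M hM w _; apply: le_trans (ltW hM).
apply: le_trans (ler_normB _ _) _; rewrite lerD2r.
apply: le_trans (ler_norm_sum _ _ _) _.
rewrite -[leRHS]mulr1 mulr_natl -[X in _ *+ X]card_ord -sumr_const.
by apply: ler_sum => t _; rewrite ger0_norm.
Qed.

(** Averaging argument: the regrets sum over [f] to a constant independent of [w], so the expected
    regrets have the same sum and cannot all be below [B]. *)
Lemma exists_regret_ge (B : R) :
  #|{: losses}|%:R * B <= \sum_f (n%:R / 2 - best_loss (loss_of f)) ->
  exists f, (B%:E <= 'E_P[regret A (loss_of f)])%E.
Proof.
move=> hB; apply: contrapT => /forallNP H.
have fin f : 'E_P[regret A (loss_of f)]%E \is a fin_num.
  by rewrite unlock; apply: integrable_fin_num => //; exact: integrable_regret.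
have lt f : fine 'E_P[regret A (loss_of f)]%E < B.
  by rewrite -lte_fin fineK// ltNge; apply/negP/H.
have E : \sum_f fine 'E_P[regret A (loss_of f)]%E = \sum_f (n%:R / 2 - best_loss (loss_of f)).
  apply: EFin_inj; rewrite -sumEFin.
  under eq_bigr do rewrite fineK// unlock.
  rewrite -integral_sum//; last by move=> f; exact: integrable_regret.
  under eq_integral => w _ do rewrite sumEFin sum_regret.
  by rewrite integral_cst// -[RHS]mule1 -(@probability_setT _ _ _ P).
move: hB; rewrite -E leNgt => /negP; apply.
rewrite mulr_natl -sumr_const; apply: ltr_sum => //.
(* Strictness of the summed inequality needs at least one loss family. *)
by apply/hasP; exists [ffun=> finset.set0 : {set 'I_n}] => //; exact: mem_index_enum.
Qed.
End algorithm.
End regret.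

(** * Binomial tail over a window of values *)

Section tail_bound.
Variable R : realType.

(** Since [N <= K], the sizes [K - j] are distinct, so each set is counted at most once. *)
Lemma sum_bin_le_card (n K N : nat) (E : pred {set 'I_n}) : (N <= K)%N ->
  (forall A : {set 'I_n}, (K < #|A| + N)%N -> (#|A| <= K)%N -> E A) ->
  (\sum_(j < N) 'C(n, K - j) <= #|E|)%N.
Proof.
move=> NK hE.
have binE k : 'C(n, k) = (\sum_(A : {set 'I_n}) (#|A| == k))%N.
  rewrite -[in LHS](card_ord n) -card_draws -sum1_card big_mkcond /=.
  by apply: eq_bigr => A _; rewrite inE; case: ifP.
under eq_bigr do rewrite binE.
rewrite exchange_big -[X in (_ <= X)%N]sum1_card [X in (_ <= X)%N]big_mkcond /=.
apply: leq_sum => A _.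
have [/existsP[j /eqP Aj]|/existsPn noj] := boolP [exists j : 'I_N, #|A| == (K - j)%N].
  have jN := ltn_ord j.
  rewrite unfold_in hE; [|lia|lia].
  rewrite (bigD1 j)//= Aj eqxx big1// => i ij.
  have /eqP : i <> j :> nat by move/ord_inj => E1; rewrite E1 eqxx in ij.
  have := ltn_ord i; case: eqP => //; lia.
by rewrite big1// => j _; rewrite (negbTE (noj j)).
Qed.

(** For [y = (2 k - n) / n] the hypotheses give [y <= y0], so monotonicity yields [ent y <= y ^ 2
    (ent y0 / y0 ^ 2) <= a ^ 2 / n], which bounds the exponent in [binomial_pmf_ge]. *)
Lemma binomial_pmf_ge_level (n k : nat) (y0 a : R) : (k < n)%N -> (n < 2 * k)%N ->
  0 < y0 < 1 -> a / Num.sqrt n%:R <= y0 * Num.sqrt (ent y0 / y0 ^+ 2) ->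
  (2 * k%:R - n%:R) * Num.sqrt (ent y0 / y0 ^+ 2) <= Num.sqrt n%:R * a ->
  expR (- (a ^+ 2 / 2)) / (2 * Num.sqrt n%:R) <= 'C(n, k)%:R / 2 ^+ n.
Proof.
move=> kn nk /andP[y00 y01]; set psi0 := ent y0 / y0 ^+ 2; set q := Num.sqrt psi0.
set r := Num.sqrt n%:R => ay ka.
have n0 : 0 < n%:R :> R by rewrite ltr0n; lia.
have r0 : 0 < r by rewrite sqrtr_gt0.
have r2 : n%:R = r ^+ 2 :> R by rewrite sqr_sqrtr// ltW.
have psi1 : 1 <= psi0 by rewrite ler_pdivlMr ?exprn_gt0// mul1r ent_ge// ltW.
have q2 : psi0 = q ^+ 2 by rewrite sqr_sqrtr//; lra.
have q0 : 0 < q by rewrite sqrtr_gt0; lra.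
have nE : (k + (n - k))%N = n by lia.
have mE : (n - k)%:R = n%:R - k%:R :> R by rewrite natrB// ltnW.
have := @binomial_pmf_ge R k (n - k) ltac:(lia) ltac:(lia).
rewrite nE mE; apply: le_trans.
rewrite ler_pM2r ?invr_gt0 ?mulr_gt0// ler_expR lerN2.
set y := ((_ - _) / _).
have yE : y = (2 * k%:R - n%:R) / n%:R by rewrite /y; field; lra.
have y_gt0 : 0 < y.
  by rewrite yE divr_gt0// subr_gt0 -natrM ltr_nat.
have yq : y * q <= a / r.
  have -> : a / r = r * a / n%:R by rewrite r2; field; lra.
  by rewrite yE mulrAC ler_pM2r ?invr_gt0.
have yy0 : y <= y0 by rewrite -(ler_pM2r q0); apply: le_trans yq _.
have := ent_div_sqr_homo y_gt0 yy0 y01.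
rewrite ler_pdivrMr ?exprn_gt0// -/psi0 q2 => ey.
have yq0 : 0 <= y * q by rewrite mulr_ge0// ltW.
have : (y * q) ^+ 2 <= (a / r) ^+ 2 by rewrite lerXn2r ?nnegrE// (le_trans yq0).
have -> : (a / r) ^+ 2 = a ^+ 2 / n%:R by rewrite r2; field; lra.
rewrite ler_pdivlMr// => h.
nra.
Qed.

Lemma ln_le_half (x : R) : 0 < x -> ln x <= x / 2.
Proof.
move=> x0.
have := @le_ln1Dx R (x / 2 - 1) ltac:(lra).
have := @le_ln1Dx R 1 ltac:(lra).
have -> : 1 + (x / 2 - 1) = x / 2 by ring.
by rewrite ln_div ?posrE// (_ : 1 + 1 = 2)//; lra.
Qed.

Lemma sqrt_2pi_ge2 : 2 <= Num.sqrt (2 * pi) :> R.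
Proof.
have hpi := @pi_ge2 R.
apply: (@le_trans _ _ (Num.sqrt (2 ^+ 2))); first by rewrite sqrtr_sqr ger0_norm.
by rewrite ler_sqrt ?expr2; lra.
Qed.

Lemma expr1B_le_expR (u : R) (d : nat) : u <= 1 -> (1 - u) ^+ d <= expR (- (d%:R * u)).
Proof.
move=> u1; rewrite -mulrN expRM_natl lerXn2r ?nnegrE ?expR_ge0 ?subr_ge0//.
exact: expR_ge1Dx.
Qed.

(** * Numerical estimates for the parameters of the bound *)

Section parameters.
Variables (n d : nat) (L s r a q : R).
Hypothesis LE : L = ln d%:R.
Hypothesis sE : s = Num.sqrt L.
Hypothesis rE : r = Num.sqrt n%:R.
Hypothesis aE : a = Num.sqrt (2 * L - 2 * ln L).
Hypothesis qE : q = Num.sqrt (psi (16 / 10 * s / (2 * r))).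
Hypothesis d_ge2 : (2 <= d)%N.
Hypothesis L_le : 3 * L <= n%:R.

Let L_ge_half : 1 / 2 <= L.
Proof.
have : ln 2 <= L by rewrite LE ler_ln ?posrE ?ler_nat// ltr0n; apply: leq_trans d_ge2.
have := @ln1D_ge R 1 ler01; rewrite (_ : 1 + 1 = 2)//; lra.
Qed.

Let L_gt0 : 0 < L.
Proof. by have := L_ge_half; lra. Qed.

Let s_gt0 : 0 < s. Proof. by rewrite sE sqrtr_gt0. Qed.
Let s_sqr : s ^+ 2 = L. Proof. by rewrite sE sqr_sqrtr// ltW. Qed.
Let r_gt0 : 0 < r.
Proof. by rewrite rE sqrtr_gt0; apply: lt_le_trans L_le; rewrite mulr_gt0. Qed.
Let r_sqr : r ^+ 2 = n%:R. Proof. by rewrite rE sqr_sqrtr. Qed.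

Let s_div_r_bounds : 0 < 16 / 10 * s / r < 1.
Proof.
have s0 := s_gt0; have r0 := r_gt0.
rewrite divr_gt0 ?mulr_gt0//= ltr_pdivrMr// mul1r.
(* It suffices that [1.6 ^ 2 = 2.56 < 3]. *)
have : 3 * s ^+ 2 <= r ^+ 2 by rewrite s_sqr r_sqr.
nra.
Qed.

Let psi_s_div_r (y0 := 16 / 10 * s / r) :
  psi (16 / 10 * s / (2 * r)) = ent y0 / y0 ^+ 2.
Proof.
have := s_div_r_bounds; rewrite -/y0 => y01.
have -> : 16 / 10 * s / (2 * r) = y0 / 2 by rewrite /y0; field; rewrite gt_eqF ?r_gt0.
rewrite psiE; [|lra|lra].
by rewrite (_ : 2 * (y0 / 2) = y0)//; field.
Qed.

Let sqrt_psi_bounds : 1 <= q <= 3 / 2.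
Proof.
have := s_div_r_bounds; have := psi_s_div_r.
set y0 := 16 / 10 * s / r => psi_y0 /andP[y00 y01].
have h1 : 1 <= psi (16 / 10 * s / (2 * r)).
  by rewrite psi_y0 ler_pdivlMr ?exprn_gt0// mul1r ent_ge// ltW.
have h2 : psi (16 / 10 * s / (2 * r)) <= 2.
  by rewrite psi_y0 ler_pdivrMr ?exprn_gt0// ent_le// ltW.
have q2 : q ^+ 2 = psi (16 / 10 * s / (2 * r)) by rewrite qE sqr_sqrtr//; lra.
have q0 : 0 < q by rewrite qE sqrtr_gt0; lra.
nra.
Qed.

Let s_ge2 : 4 <= L -> 2 <= s.
Proof. by have := s_sqr; have := s_gt0; nra. Qed.

Let a_sqr : a ^+ 2 = 2 * L - 2 * ln L.
Proof. by rewrite aE sqr_sqrtr//; move: L_gt0; have := ln_le_half L_gt0; lra. Qed.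

Let a_bounds : 4 <= L -> 2 <= a <= 16 / 10 * s.
Proof.
move=> L_ge4; have a0 : 0 <= a by rewrite aE sqrtr_ge0.
have l0 : 0 <= ln L by rewrite ln_ge0//; lra.
(* Here [L <= a ^ 2 <= 2 L], and [2 < 1.6 ^ 2]. *)
have := ln_le_half L_gt0; have := a_sqr; have := s_sqr; have := s_gt0; nra.
Qed.

Let level_ge0 : 4 <= L -> 0 <= r * ((a - 1) / q - 1 / 2).
Proof.
move=> L_ge4; have := sqrt_psi_bounds; have := a_bounds L_ge4 => a12 q12.
by rewrite mulr_ge0 ?(ltW r_gt0)// subr_ge0 ler_pdivlMr; lra.
Qed.

Let tail_ge (level := r * ((a - 1) / q - 1 / 2)) : 4 <= L ->
  s / (31 / 10 * Num.sqrt (2 * pi)) <=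
  d%:R * (#|[pred A : {set 'I_n} | level <= 2 * #|A|%:R - n%:R]|%:R / 2 ^+ n).
Proof.
move=> L_ge4; have s0 := s_gt0; have r0 := r_gt0; have s2 := s_ge2 L_ge4.
have := s_div_r_bounds; have := psi_s_div_r.
set y0 := 16 / 10 * s / r => psi_y0 y0_bounds.
have /andP[q1 q32] := sqrt_psi_bounds; have /andP[a1 as_] := a_bounds L_ge4.
have q0 : 0 < q by lra.
have d0 : 0 < d%:R :> R by rewrite ltr0n; apply: leq_trans d_ge2.
have rs : 3 * s ^+ 2 <= r ^+ 2 by rewrite s_sqr r_sqr.
have r3 : 34 / 10 <= r by nra.
have V0 : 0 < q^-1 by rewrite invr_gt0.
have V1 : 2 / 3 <= q^-1 by rewrite -[leLHS]invrK lef_pV2 ?posrE//; lra.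
have V2 : q^-1 <= 1 by rewrite invf_le1.
(* The window consists of the [N] values [K - j] with [j < N]. *)
pose U := r * a * q^-1.
have U0 : 0 <= U by rewrite !mulr_ge0//; lra.
have Ur : U < n%:R.
  have : U <= r * a by rewrite ler_piMr// mulr_ge0//; lra.
  by move/le_lt_trans; apply; rewrite -r_sqr expr2 ltr_pM2l// (le_lt_trans as_)//; nra.
(* [K] is the largest size whose walk value is at most [U]. The window spans at most
   [7 r / 6 = 2 r / 3 + r / 2] in walk values, which fits above [level = U - r / q - r / 2] because
   [1 / q >= 2 / 3]. *)
pose K := Num.truncn ((n%:R + U) / 2); pose N := Num.truncn (7 / 12 * r).
have /andP[K1 K2] : K%:R <= (n%:R + U) / 2 < K%:R + 1.
  by rewrite natr1 truncn_itv//; lra.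
have /andP[N1 N2] : N%:R <= 7 / 12 * r < N%:R + 1 by rewrite natr1 truncn_itv//; lra.
have C0 : 0 <= level by exact: level_ge0.
have CU : level <= U - 7 / 6 * r.
  have -> : level = U - r * q^-1 - r / 2 by rewrite /level /U; ring.
  have : r * (2 / 3) <= r * q^-1 by rewrite ler_wpM2l// ltW.
  lra.
have r_le : 2 * r <= n%:R by rewrite -r_sqr expr2 ler_pM2r//; lra.
have NK : (N < K)%N by rewrite -(ltr_nat R); lra.
have hE (A : {set 'I_n}) : (K < #|A| + N)%N -> (#|A| <= K)%N -> level <= 2 * #|A|%:R - n%:R.
  by rewrite -addn1 -(ler_nat R) !natrD => h _; lra.
have := sum_bin_le_card (ltnW NK) hE; set m := #|_|.
rewrite -(ler_nat R) natr_sum => mE.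
have pmf (j : 'I_N) : L / (2 * d%:R * r) <= 'C(n, K - j)%:R / 2 ^+ n.
  have jN : j%:R + 1 <= N%:R :> R by rewrite natr1 ler_nat.
  have kE : (K - j)%:R = K%:R - j%:R :> R
    by rewrite natrB// (leq_trans (ltnW (ltn_ord j)) (ltnW NK)).
  have j0 : 0 <= j%:R :> R by [].
  have := @binomial_pmf_ge_level n (K - j) y0 a.
  rewrite -psi_y0 -qE -rE => pm; apply: le_trans (pm _ _ _ _ _).
  (* The choice of [a] makes [exp (- a ^ 2 / 2)] equal to [L / d]. *)
  - rewrite a_sqr (_ : - ((2 * L - 2 * ln L) / 2) = ln L - L); last by field.
    rewrite expRD expRN [in expR L]LE !lnK ?posrE// le_eqVlt; apply/orP; left; apply/eqP.
    by field; lra.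
  - by rewrite -(ltr_nat R) kE; lra.
  - by rewrite -(ltr_nat R) natrM kE; lra.
  - by [].
  - by rewrite /y0 mulrAC ler_pM2r ?invr_gt0// (le_trans as_)// ler_peMr//; lra.
  - by rewrite -ler_pdivlMr// -/U kE; lra.
have : N%:R * (L / (2 * d%:R * r)) <= m%:R / 2 ^+ n.
  apply: (@le_trans _ _ (\sum_(j < N) 'C(n, K - j)%:R / 2 ^+ n)).
    by rewrite -[N in N%:R]card_ord mulr_natl -sumr_const; apply: ler_sum => j _; exact: pmf.
  by rewrite -mulr_suml ler_pM2r ?invr_gt0 ?exprn_gt0.
rewrite -(ler_pM2l d0); apply: le_trans.
have -> : d%:R * (N%:R * (L / (2 * d%:R * r))) = s * (s * N%:R / (2 * r)).
  by rewrite -s_sqr; field; lra.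
rewrite ler_pM2l//.
have p2 := sqrt_2pi_ge2.
(* The left side is at most [1 / 6.2]; the right is at least [N / r], since [s >= 2], and
   [N > 7 r / 12 - 1] with [r >= 3.4]. *)
apply: (@le_trans _ _ (1 / 5)).
  rewrite -div1r ler_pdivrMr ?mulr_gt0//; lra.
rewrite ler_pdivlMr ?mulr_gt0//.
have : 2 * N%:R <= s * N%:R by rewrite ler_wpM2r.
lra.
Qed.

(** For [4 <= L], a lower bound on the probability that some walk reaches the level. *)
Let F := 1 - expR (- (s / (31 / 10 * Num.sqrt (2 * pi)))).

(** From [1 - exp (- v) <= v] and [sqrt (2 pi) >= 2], [F / q <= s / 6]; hence [s (a - 1) <= 6]
    suffices. *)
Lemma bound_le0_of_small : L <= 4 -> F / q * (r / 2) * (a - 1) - r / 2 <= 0.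
Proof.
move=> L4; have Lh := L_ge_half.
have s0 := s_gt0; have s2 := s_sqr.
have r0 := r_gt0.
have /andP[q1 _] := sqrt_psi_bounds.
have p2 := sqrt_2pi_ge2.
have F0 : 0 <= F.
  rewrite subr_ge0 -[leRHS]expR0 ler_expR oppr_le0 divr_ge0 ?mulr_ge0//; lra.
have Fs : F <= s / 6.
  apply: (@le_trans _ _ (s / (31 / 10 * Num.sqrt (2 * pi)))).
    by rewrite /F; set v := s / _; have := expR_ge1Dx (- v); lra.
  rewrite ler_pM2l// lef_pV2 ?posrE ?mulr_gt0//; lra.
have Fq0 : 0 <= F / q by rewrite divr_ge0//; lra.
have Fq : F / q <= s / 6.
  by apply: le_trans Fs; rewrite ler_pdivrMr ?ler_peMr//; lra.
have a0 : 0 <= a by rewrite aE sqrtr_ge0.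
have sle : s <= 2 by nra.
have lnL : - ln L <= 1.
  rewrite -lnV ?posrE//.
  have V2 : L^-1 <= 2 by rewrite -[leRHS]invrK lef_pV2 ?posrE//; lra.
  have V0 : 0 < L^-1 by rewrite invr_gt0.
  by have := @le_ln1Dx R (L^-1 - 1) ltac:(lra); rewrite addrCA subrr addr0; lra.
(* For [L >= 1], [a <= 2 s] and [s <= 2]. For [L < 1] the term [- 2 ln L] is positive but at most 2,
   so [a <= 2]. *)
have as_ : s * (a - 1) <= 6.
  have [L1|L1] := leP 1 L.
    have aL : a ^+ 2 <= 2 * s ^+ 2.
      rewrite s2 aE; have := ln_ge0 L1 => l0.
      have := ln_le_half L_gt0 => l2.
      by rewrite sqr_sqrtr; lra.
    have : a <= 2 * s by nra.
    nra.
  have l0 := ln_le0 (ltW L1).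
  have aL : a ^+ 2 <= 4 by rewrite aE sqr_sqrtr; lra.
  have : a <= 2 by nra.
  nra.
have key : F / q * (a - 1) <= 1.
  have [a1|a1] := leP 1 a; last by have : 0 <= F / q * (1 - a) by [rewrite mulr_ge0//; lra]; lra.
  have : F / q * (a - 1) <= s / 6 * (a - 1) by rewrite ler_wpM2r//; lra.
  lra.
have : r / 2 * (F / q * (a - 1)) <= r / 2 by rewrite ler_piMr//; lra.
lra.
Qed.

Lemma bound_le_sum_gap (M : {ffun 'I_d -> {set 'I_n}} -> R) :
  (forall f i, M f <= n%:R - #|f i|%:R) ->
  #|{: {ffun 'I_d -> {set 'I_n}}}|%:R * (F / q * (r / 2) * (a - 1) - r / 2) <=
    \sum_f (n%:R / 2 - M f).
Proof.
move=> hM.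
have d0 : (0 < d)%N by apply: leq_trans d_ge2.
have [L4|/ltW L4] := leP L 4.
  apply: le_trans (sum_gap_ge0 d0 hM).
  by rewrite mulr_ge0_le0// bound_le0_of_small.
have r0 := r_gt0.
have n0 : (0 < n)%N by rewrite -(ltr0n R); apply: lt_le_trans L_le; rewrite mulr_gt0.
have C0 := level_ge0 L4.
have T := tail_ge L4.
set E := [pred A : {set 'I_n} | _] in T.
apply: le_trans (sum_gap_ge n0 d0 C0 hM (E := E) _) => //.
rewrite ler_wpM2l// -rE.
set p := 1 - _ ^+ d.
have u1 : #|E|%:R / 2 ^+ n <= 1 :> R.
  rewrite ler_pdivrMr ?exprn_gt0// mul1r -natrX ler_nat.
  by rewrite (leq_trans (max_card _))// card_set_type card_ord.
have Fp : F <= p.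
  rewrite lerD2l lerN2; apply: le_trans (expr1B_le_expR d u1) _.
  by rewrite ler_expR lerN2.
have F1 : F <= 1 by rewrite gerBl expR_ge0.
set C := r * _ in C0 *.
have CF : C / 2 * F <= C / 2 * p by rewrite ler_wpM2l//; lra.
have : F * r <= r by rewrite ler_piMl// ltW.
have /andP[q1 _] := sqrt_psi_bounds.
(* The losses [F r / 4] here and [r / 4] from [sum_gap_ge] add up to at most the final [r / 2]. *)
have : C / 2 * F = F / q * (r / 2) * (a - 1) - F * r / 4 by rewrite /C; field; lra.
lra.
Qed.
End parameters.
End tail_bound.

Theorem theorem8 (R : realType) (n d : nat)
    (hn : (7 <= n)%N) (hd2 : (2 <= d)%N)
    (hdn : (d%:R : R) <= expR (n%:R / 3))
    (disp : measure_display) (Omega : measurableType disp)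
    (P : probability Omega R) (A : expert_algorithm R Omega d) :
  exists loss : 'I_n -> 'I_d -> {i01 R},
    (forall t i, (loss t i)%:num = 0 \/ (loss t i)%:num = 1) /\
    (((1 - expR (- (Num.sqrt (ln d%:R) / (31 / 10 * Num.sqrt (2 * pi)))))
        / Num.sqrt (psi (16 / 10 * Num.sqrt (ln d%:R) / (2 * Num.sqrt n%:R)))
        * (Num.sqrt n%:R / 2)
        * (Num.sqrt (2 * ln d%:R - 2 * ln (ln d%:R)) - 1)
      - Num.sqrt n%:R / 2)%:E
     <= 'E_P[regret A loss])%E.
Proof.
have L_le : 3 * ln d%:R <= n%:R :> R.
  have d0 : 0 < d%:R :> R by rewrite ltr0n; apply: leq_trans hd2.
  have : ln d%:R <= n%:R / 3 :> R by rewrite -ler_expR lnK ?posrE.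
  lra.
have [f hf] := @exists_regret_ge R n d _ _ P A _ (bound_le_sum_gap (erefl _) (erefl _)
  (erefl _) (erefl _) (erefl _) hd2 L_le (@best_loss_of_le R n d)).
exists (loss_of R f); split=> // t i.
by rewrite loss_ofE; case: (t \in f i); [left|right].
Qed.
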